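(* Let $G$ and $H$ be graphs, each of order at least $2$. Then: (i) for any $k\in\{1,\ldots,\mathcal{C}(G+H)\}$, $\operatorname{adim}_k(G+H)\ge\operatorname{adim}_k(G)+\operatorname{adim}_k(H)$; (ii) for any $k\in\{1,\ldots,\min\{\mathcal{C}(H),\mathcal{C}(K_1+G)\}\}$, $\operatorname{adim}_k(G+H)\le\operatorname{adim}_k(K_1+G)+\operatorname{adim}_k(H)$.
   Context: All graphs are finite and simple. The join $G+H$ of vertex-disjoint graphs $G,H$ has vertex set $V(G)\cup V(H)$ and edge set $E(G)\cup E(H)\cup\{uv:u\in V(G),v\in V(H)\}$; $K_1$ is the one-vertex graph. For a graph $G=(V,E)$, $d_{G,2}(x,y)=\min\{d_G(x,y),2\}$ with $d_G$ the shortest-path distance ($\infty$ between different components). For distinct $x,y$, $\mathcal{C}_G(x,y)=\{z\in V: d_{G,2}(x,z)\ne d_{G,2}(y,z)\}$, $\mathcal{C}(G)=\min_{x\ne y}|\mathcal{C}_G(x,y)|$. A set $S\subseteq V$ is a $k$-adjacency generator if $|S\cap\mathcal{C}_G(x,y)|\ge k$ for all distinct $x,y$; $\operatorname{adim}_k(G)$ is the minimum cardinality of such a set. *)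

(* Defs.v *)
From mathcomp Require Import all_boot.

Set Implicit Arguments.
Unset Strict Implicit.
Unset Printing Implicit Defensive.

Record sgraph := SGraph {
  vertex :> finType;
  edge : rel vertex;
  edge_sym : symmetric edge;
  edge_irrefl : irreflexive edge
}.

Section Join.
Variables G H : sgraph.

Definition join_edge (u v : vertex G + vertex H) : bool :=
  match u, v with
  | inl x, inl y => edge x y
  | inr x, inr y => edge x y
  | _, _ => true
  end.

Lemma join_edge_sym : symmetric join_edge.
Proof. by move=> [x|x] [y|y] //=; apply: edge_sym. Qed.

Lemma join_edge_irrefl : irreflexive join_edge.
Proof. by move=> [x|x] /=; apply: edge_irrefl. Qed.

Definition join : sgraph := SGraph join_edge_sym join_edge_irrefl.

End Join.

Lemma K1_edge_sym : symmetric (fun _ _ : unit => false). Proof. by []. Qed.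
Lemma K1_edge_irrefl : irreflexive (fun _ : unit => xpred0 : pred unit).
Proof. by []. Qed.

Definition K1 : sgraph := SGraph K1_edge_sym K1_edge_irrefl.

Section Adjacency.
Variable G : sgraph.
Implicit Types (x y z : G) (S : {set G}) (k n : nat).

Definition has_walk x y n : bool :=
  [exists p : n.-tuple G, path (@edge G) x p && (last x p == y)].

Lemma has_walk_ex x y : connect (@edge G) x y -> exists n, has_walk x y n.
Proof.
case/connectP=> p ep ->; exists (size p).
by apply/existsP; exists (in_tuple p); rewrite /= ep eqxx.
Qed.

(* The length of a shortest walk is the shortest-path distance; [None] stands
   for the infinite distance between different components. *)
Definition dist x y : option nat :=
  match @idP (connect (@edge G) x y) with
  | ReflectT xy => Some (ex_minn (has_walk_ex xy))
  | ReflectF _ => None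
  end.

Definition dist2 x y : nat := if dist x y is Some n then minn n 2 else 2.

Definition distinguishers x y : {set G} :=
  [set z | dist2 x z != dist2 y z].

(* All the cardinals are at most [#|G|], so the default value does not affect
   the minimum as soon as [G] has two distinct vertices. *)
Definition adj_dimensionality : nat :=
  \big[minn/#|G|]_(p : G * G | p.1 != p.2) #|distinguishers p.1 p.2|.

Definition adj_generator k S : bool :=
  [forall x : G, forall y : G,
    (x != y) ==> (k <= #|S :&: distinguishers x y|)].

(* The minimum is over a nonempty family exactly when the whole vertex set is a
   generator; for [G] of order at least 2 this means
   [k <= adj_dimensionality].  Otherwise the value is the meaningless default
   [#|G|]. *)
Definition adim k : nat := \big[minn/#|G|]_(S | adj_generator k S) #|S|.

End Adjacency.

Arguments adj_dimensionality G : clear implicits.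
Arguments adim G k : clear implicits.

Section BigMin.
Variables (I : finType) (P : pred I) (F : I -> nat) (d : nat).

Lemma bigminn_leP m :
  reflect (m <= d /\ forall i, P i -> m <= F i)
          (m <= \big[minn/d]_(i | P i) F i).
Proof.
apply: (iffP idP) => [le_m | [le_d le_F]].
  split=> [|i Pi]; apply: leq_trans le_m _.
    by elim/big_rec: _ => // i x _ h; rewrite geq_min h orbT.
  elim: (index_enum I) (mem_index_enum i) => // j r IHr.
  rewrite in_cons big_cons; case/predU1P=> [<-|/IHr le_r].
    by rewrite Pi geq_minl.
  by case: ifP => // _; rewrite geq_min le_r orbT.
by elim/big_ind: _ => // x y hx hy; rewrite leq_min hx.
Qed.

Lemma bigminn_attained i0 : P i0 -> (forall i, P i -> F i <= d) ->
  exists2 i, P i & F i = \big[minn/d]_(i | P i) F i.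
Proof.
move=> Pi0 le_d; case: (arg_minnP F Pi0) => i Pi min_i; exists i => //.
apply/eqP; rewrite eqn_leq; apply/andP; split.
  by apply/bigminn_leP; split; [apply: le_d|].
by have /bigminn_leP[_ ->] := leqnn (\big[minn/d]_(i | P i) F i).
Qed.

End BigMin.

Lemma leq_adj_dimensionality (G : sgraph) k : 1 < #|G| ->
  (k <= adj_dimensionality G) = adj_generator k [set: G].
Proof.
move=> /card_gt1P[a [b [_ _ ab]]].
apply/bigminn_leP/forallP => [[_ h] x | h].
  by apply/forallP=> y; apply/implyP=> xy; rewrite setTI; apply: (h (x, y)).
have h' (x y : G) : x != y -> k <= #|distinguishers x y|.
  by move=> xy; have /forallP/(_ y)/implyP/(_ xy) := h x; rewrite setTI.
split; last by case=> x y; apply: h'.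
exact: leq_trans (h' _ _ ab) (max_card _).
Qed.

Lemma adim_attained (G : sgraph) k : 1 < #|G| -> k <= adj_dimensionality G ->
  exists2 S : {set G}, adj_generator k S & #|S| = adim G k.
Proof.
move=> G2; rewrite leq_adj_dimensionality // => kT.
by apply: (bigminn_attained kT) => S _; apply: max_card.
Qed.

Lemma adim_min (G : sgraph) k (S : {set G}) :
  adj_generator k S -> adim G k <= #|S|.
Proof. by move=> kS; have /bigminn_leP[_ ->] := leqnn (adim G k). Qed.

(* Main.v *)
Require Import Defs.
From mathcomp Require Import all_boot.

(** In a join, two vertices of the same side are distinguished exactly by the
    vertices distinguishing them within that side, while [x] and [y] on
    different sides are distinguished by the non-neighbours of [x] on its side
    and those of [y] on its side, with [x] and [y] themselves included.  Hence
    both parts of a generator of [G + H] are generators, which gives (i).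
    For (ii), take a generator [A] of [K1 + G] and a generator [B] of [H].  The
    [K1] vertex matters only for the pairs (K1 vertex, [x]), where it counts
    once; after deleting it from [A], the loss has to be made up for by one
    vertex of [H] not adjacent to [y], for every [y].  If [B] has no such vertex
    for some [y], then [y] is unique, since [B] does not distinguish two such
    vertices, and it suffices to add [y] itself to [B]. *)

(** * Truncated distance and non-neighbours *)

Section Distance.
Variable G : sgraph.
Implicit Types (x y z : G) (S T B : {set G}).

(** By irreflexivity of [edge], this set contains [x] itself. *)
Definition nonneighbours x : {set G} := [set z | ~~ edge x z].

Lemma has_walk0 x y : has_walk x y 0 = (x == y).
Proof.
apply/existsP/idP => [[p]|xy]; first by rewrite tuple0.
by exists [tuple].
Qed.

Lemma has_walk1 x y : has_walk x y 1 = edge x y.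
Proof.
apply/existsP/idP => [[p]|xy].
  by case/tupleP: p => z p; rewrite tuple0 /= andbT => /andP[xz /eqP <-].
by exists [tuple y]; rewrite /= xy eqxx.
Qed.

(** Truncation at 2 leaves only equality and adjacency visible, so walks can be forgotten from here
    on. *)
Lemma dist2E x y :
  dist2 x y = if x == y then 0 else if edge x y then 1 else 2.
Proof.
(* Infinite distance truncates to 2, which fits the last branch: vertices in different components
   are neither equal nor adjacent. *)
rewrite /dist2 /dist; case: {-}_ / idP => [xy|nxy]; last first.
  case: eqP => [exy|_]; first by case: nxy; rewrite exy connect0.
  by case: ifP => // exy; case: nxy; apply: connect1.
case: ex_minnP => m + min_m.
case: m min_m => [|[|m]] min_m; rewrite ?has_walk0 ?has_walk1.
- by move=> ->.
- move=> exy; rewrite exy; case: eqP => // xy0.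
  by have := edge_irrefl x; rewrite {2}xy0 exy.
- move=> _; case: eqP => [xy0|_].
    by have := min_m 0; rewrite has_walk0 xy0 eqxx => /(_ isT).
  case: ifP => [exy|_]; last by rewrite !minnSS minn0.
  by have := min_m 1; rewrite has_walk1 exy => /(_ isT).
Qed.

Lemma dist2_eq1 x y : (dist2 x y == 1) = edge x y.
Proof.
rewrite dist2E; case: (eqVneq x y) => [->|_]; first by rewrite edge_irrefl.
by case: edge.
Qed.

Lemma adj_generatorP k S :
  reflect (forall x y, x != y -> k <= #|S :&: distinguishers x y|)
          (adj_generator k S).
Proof.
apply: (iffP forallP) => [h x y|h x].
  by move/forallP: (h x) => /(_ y)/implyP.
by apply/forallP=> y; apply/implyP/h.
Qed.

Lemma adj_generatorS k S T :
  S \subset T -> adj_generator k S -> adj_generator k T.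
Proof.
move=> sST /adj_generatorP genS; apply/adj_generatorP=> x y xy.
by apply: leq_trans (genS x y xy) _; rewrite subset_leq_card ?setSI.
Qed.

(** As [k] is positive, some vertex of [B] would distinguish distinct [x] and [y]; but it is
    adjacent to both, hence at distance 1 from each. *)
Lemma nonneighbour_free_unique k B x y : 0 < k -> adj_generator k B ->
  B :&: nonneighbours x = set0 -> B :&: nonneighbours y = set0 -> x = y.
Proof.
move=> k_gt0 /adj_generatorP genB Bx By; apply/eqP/negPn/negP => xy.
have := leq_trans k_gt0 (genB x y xy); rewrite card_gt0 => /set0Pn[z].
rewrite !inE => /andP[zB].
have adj u : B :&: nonneighbours u = set0 -> dist2 u z = 1.
  move=> /setP/(_ z); rewrite !inE zB => /negbFE euz.
  by apply/eqP; rewrite dist2_eq1.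
by rewrite !adj.
Qed.

Lemma adj_generator_nonneighbour k B : 0 < k -> adj_generator k B ->
  exists T, [/\ adj_generator k T, #|T| <= #|B|.+1
              & forall y, 0 < #|T :&: nonneighbours y|].
Proof.
move=> k_gt0 genB.
have [y /eqP By|noB] := pickP (fun y => B :&: nonneighbours y == set0); last first.
  by exists B; split=> // y; rewrite card_gt0 noB.
exists (y |: B); split.
- exact: adj_generatorS (subsetUr _ _) genB.
- by rewrite cardsU1 -add1n leq_add2r leq_b1.
move=> z; rewrite card_gt0 setIUl.
have [Bz|nBz] := eqVneq (B :&: nonneighbours z) set0; last by rewrite setU_eq0 negb_and nBz orbT.
(* Here [z] is the exceptional vertex [y], which is its own non-neighbour. *)
rewrite (nonneighbour_free_unique _ _ _ _ k_gt0 genB Bz By).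
by apply/set0Pn; exists y; rewrite !inE eqxx edge_irrefl.
Qed.

End Distance.

Arguments nonneighbours {G} x.

Section SumSets.
Variables U V : finType.
Implicit Types (A : {set U}) (B : {set V}) (S : {set U + V}).

Definition lpart S : {set U} := [set x | inl x \in S].
Definition rpart S : {set V} := [set y | inr y \in S].
Definition sumset A B : {set U + V} :=
  [set z | match z with inl x => x \in A | inr y => y \in B end].

Lemma lpart_sumset A B : lpart (sumset A B) = A.
Proof. by apply/setP=> x; rewrite !inE. Qed.

Lemma rpart_sumset A B : rpart (sumset A B) = B.
Proof. by apply/setP=> x; rewrite !inE. Qed.

Lemma lpartI S T : lpart (S :&: T) = lpart S :&: lpart T.
Proof. by apply/setP=> x; rewrite !inE. Qed.

Lemma rpartI S T : rpart (S :&: T) = rpart S :&: rpart T.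
Proof. by apply/setP=> x; rewrite !inE. Qed.

Lemma card_parts S : #|S| = #|lpart S| + #|rpart S|.
Proof.
rewrite -!sum1_card big_sumType.
by congr (_ + _); apply: eq_bigl => x; rewrite !inE.
Qed.

End SumSets.

Arguments lpart {U V} S.
Arguments rpart {U V} S.
Arguments sumset {U V} A B.

(** * Distinguishing vertices in a join *)

Section JoinDistinguishers.
Variables G H : sgraph.
Implicit Types (S : {set join G H}) (k : nat).

Local Notation il x := (inl x : join G H).
Local Notation ir x := (inr x : join G H).

(** Equality and adjacency within [G] survive in the join, and every vertex of [H] is at distance 1
    from both [x] and [y]. *)
Lemma card_distinguishers_inl S (x y : G) :
  #|S :&: distinguishers (il x) (il y)| = #|lpart S :&: distinguishers x y|.
Proof.
rewrite (card_parts G H) lpartI rpartI.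
have -> : lpart (distinguishers (il x) (il y)) = distinguishers x y.
  by apply/setP=> z; rewrite !inE !dist2E.
have -> : rpart (distinguishers (il x) (il y)) = set0.
  by apply/setP=> z; rewrite !inE !dist2E.
by rewrite setI0 cards0 addn0.
Qed.

Lemma card_distinguishers_inr S (x y : H) :
  #|S :&: distinguishers (ir x) (ir y)| = #|rpart S :&: distinguishers x y|.
Proof.
rewrite (card_parts G H) lpartI rpartI.
have -> : rpart (distinguishers (ir x) (ir y)) = distinguishers x y.
  by apply/setP=> z; rewrite !inE !dist2E.
have -> : lpart (distinguishers (ir x) (ir y)) = set0.
  by apply/setP=> z; rewrite !inE !dist2E.
by rewrite setI0 cards0.
Qed.

(** A vertex of [G] is at distance 1 from [y], so it distinguishes the pair exactly when it is not
    adjacent to [x]; the same holds with the sides exchanged. *)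
Lemma card_distinguishers_cross S (x : G) (y : H) :
  #|S :&: distinguishers (il x) (ir y)| =
  #|lpart S :&: nonneighbours x| + #|rpart S :&: nonneighbours y|.
Proof.
rewrite (card_parts G H) lpartI rpartI.
have -> : lpart (distinguishers (il x) (ir y)) = nonneighbours x.
  apply/setP=> z.
  by rewrite !inE -[edge x z]/(edge (il x) (il z)) -dist2_eq1 !dist2E.
suff -> : rpart (distinguishers (il x) (ir y)) = nonneighbours y by [].
apply/setP=> z.
by rewrite !inE -[edge y z]/(edge (ir y) (ir z)) -dist2_eq1 !dist2E eq_sym.
Qed.

Lemma adj_generator_join k S :
  adj_generator k S <->
  [/\ adj_generator k (lpart S), adj_generator k (rpart S)
    & forall x y, k <= #|lpart S :&: nonneighbours x|
                       + #|rpart S :&: nonneighbours y|].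
Proof.
split=> [/adj_generatorP gen|[/adj_generatorP genl /adj_generatorP genr cross]].
  split=> [||x y].
  - by apply/adj_generatorP=> x y xy; rewrite -card_distinguishers_inl gen.
  - by apply/adj_generatorP=> x y xy; rewrite -card_distinguishers_inr gen.
  by rewrite -card_distinguishers_cross gen.
apply/adj_generatorP=> -[x|x] [y|y] xy.
- by rewrite card_distinguishers_inl genl.
- by rewrite card_distinguishers_cross.
- have -> : distinguishers (ir x) (il y) = distinguishers (il y) (ir x).
    by apply/setP=> z; rewrite !inE eq_sym.
  by rewrite card_distinguishers_cross.
- by rewrite card_distinguishers_inr genr.
Qed.

End JoinDistinguishers.

Theorem theorem44 (G H : sgraph) (hG : 2 <= #|G|) (hH : 2 <= #|H|) :
  (forall k : nat, 1 <= k -> k <= adj_dimensionality (join G H) ->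
     adim (join G H) k >= adim G k + adim H k) /\
  (forall k : nat, 1 <= k ->
     k <= minn (adj_dimensionality H) (adj_dimensionality (join K1 G)) ->
     adim (join G H) k <= adim (join K1 G) k + adim H k).
Proof.
have join_gt1 (F F' : sgraph) : 1 < #|F'| -> 1 < #|join F F'|.
  by move=> F'2; rewrite card_sum (leq_trans F'2) ?leq_addl.
split=> k k_gt0.
  move=> /(adim_attained (join_gt1 _ _ hH))[S genS <-].
  have [genl genr _] := proj1 (adj_generator_join G H k S) genS.
  by rewrite (card_parts G H) leq_add ?adim_min.
rewrite leq_min => /andP[/(adim_attained hH)[B genB <-]].
move=> /(adim_attained (join_gt1 _ _ hG))[A genA <-].
have [_ genAr crossA] := proj1 (adj_generator_join K1 G k A) genA.
set A1 := lpart A in crossA; set AG := rpart A in genAr crossA.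
have A1_le1 : #|A1| <= 1 by rewrite (leq_trans (max_card _)) ?card_unit.
(* If [A1] is empty, [B] itself serves; otherwise the deleted [K1] vertex pays for one extra vertex
   in [H]. *)
have [T [genT cardT hitT]] : exists T : {set H},
    [/\ adj_generator k T, #|T| <= #|A1| + #|B|
      & forall y, #|A1| <= #|T :&: nonneighbours y|].
  case: #|A1| A1_le1 => [|[|//]] _; first by exists B.
  exact: adj_generator_nonneighbour k_gt0 genB.
apply: (@leq_trans #|(sumset AG T : {set join G H})|).
  apply/adim_min/adj_generator_join; rewrite lpart_sumset rpart_sumset.
  split=> // x y; apply: leq_trans (crossA tt x) _.
  (* The [K1] vertex contributed at most [#|A1|] to the cross count, and [T] supplies that many
     non-neighbours of [y]. *)
  rewrite addnC leq_add2l (leq_trans _ (hitT y)) //.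
  by rewrite subset_leq_card ?subsetIl.
rewrite (card_parts G H) lpart_sumset rpart_sumset (card_parts K1 G A).
by rewrite addnAC addnC leq_add2r.
Qed.
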